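(* Let $D$ be an integral domain with quotient field $F$, let $\mathcal{K}(D)$ be the ordered monoid of all nonzero $D$-submodules of $F$, and let $\mathcal{F}(D)$ be the ordered monoid of all nonzero fractional ideals of $D$. (1) For any star operation $*$ on $D$, there exists a unique smallest semistar operation $s( * )$ on $D$ such that $s( * )|_{\mathcal{F}(D)}=*$, and for all $I\in\mathcal{K}(D)$ one has $$I^{s( * )}=\bigcap\{K\in\mathcal{K}(D):\ K\supset I\text{ and }\forall J\in\mathcal{F}(D)\ (J\subset K\Rightarrow J^*\subset K)\}.$$ (2) More generally, for any nucleus $\gamma$ on a submonoid $\mathcal{M}$ of $\mathcal{K}(D)$ containing the set of all nonzero principal $D$-submodules of $F$, there exists a unique smallest semistar operation $\star$ on $D$ such that $\star|_{\mathcal{M}}=\gamma$, and for all $I\in\mathcal{K}(D)$ one has $$I^{\star}=\bigcap\{K\in\mathcal{K}(D):\ K\supset I\text{ and }\forall J\in\mathcal{M}\ (J\subset K\Rightarrow J^\gamma\subset K)\}.$$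
   Context: A fractional ideal of $D$ is a $D$-submodule $I$ of $F$ with $aI\subset D$ for some nonzero $a\in F$. $\mathcal{K}(D)$ and $\mathcal{F}(D)$ are ordered by inclusion, with the usual multiplication of $D$-submodules. For a self-map write $x^\star=\star(x)$. A closure operation on a poset is an expansive ($x\le x^\star$), order-preserving, idempotent self-map. A nucleus on an ordered magma is a closure operation $\star$ with $x^\star y^\star\le(xy)^\star$ for all $x,y$. A semistar operation on $D$ is a closure operation $\star$ on the poset $\mathcal{K}(D)$ such that $(aI)^\star=aI^\star$ for all nonzero $a\in F$ and $I\in\mathcal{K}(D)$. A star operation on $D$ is a closure operation $*$ on the poset $\mathcal{F}(D)$ such that $D^*=D$ and $(aI)^*=aI^*$ for all nonzero $a\in F$ and $I\in\mathcal{F}(D)$. Semistar operations are ordered pointwise: $\star_1\le\star_2$ (smaller) if $I^{\star_1}\subset I^{\star_2}$ for all $I$. *)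

(* Defs.v *)
From HB Require Import structures.
From mathcomp Require Import all_boot all_order all_algebra.
From mathcomp Require Import fraction monoid.
From mathcomp Require Import boolp classical_sets.

Set Implicit Arguments.
Unset Strict Implicit.
Unset Printing Implicit Defensive.

Import Order.TTheory GRing.Theory.

Local Open Scope classical_set_scope.
Local Open Scope ring_scope.

HB.mixin Record isOrderedMagma d T of Order.POrder d T & Magma T := {
  mulg_le : forall x x' y y' : T,
    (x <= x')%O -> (y <= y')%O -> ((x * y)%g <= (x' * y')%g)%O
}.

#[short(type="orderedMagmaType")]
HB.structure Definition OrderedMagma d :=
  {T of Order.POrder d T & Magma T & isOrderedMagma d T}.

#[short(type="orderedMonoidType")]
HB.structure Definition OrderedMonoid d :=
  {T of OrderedMagma d T & Monoid T}.

Definition closure_operation d (T : porderType d) (c : T -> T) : Prop :=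
  [/\ forall x, (x <= c x)%O,
      {homo c : x y / (x <= y)%O} &
      forall x, c (c x) = c x].

Definition nucleus d (T : orderedMagmaType d) (c : T -> T) : Prop :=
  closure_operation c /\ forall x y, ((c x * c y)%g <= c (x * y)%g)%O.

Section Submonoid.
Context d (T : orderedMonoidType d) (M : umagmaClosed T).

Record submonoid := Submonoid { submonoid_val :> T; _ : submonoid_val \in M }.

HB.instance Definition _ := [isSub for submonoid_val].
HB.instance Definition _ := [Choice of submonoid by <:].

Lemma submonoid_closed : monoid_closed (mem M).
Proof. by split; [exact: gpred1 | move=> x y; exact: gpredM]. Qed.

HB.instance Definition _ :=
  SubChoice_isSubMonoid.Build T (mem M) submonoid submonoid_closed.
HB.instance Definition _ :=
  [SubChoice_isSubPOrder of submonoid by <: with d].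

Lemma submonoid_mulg_le (x x' y y' : submonoid) :
  (x <= x')%O -> (y <= y')%O -> ((x * y)%g <= (x' * y')%g)%O.
Proof. by rewrite -!Order.le_val !valM; exact: mulg_le. Qed.

HB.instance Definition _ := isOrderedMagma.Build d submonoid submonoid_mulg_le.

End Submonoid.

(* The quotient field as a D-module; the library gives it no such structure. *)
Section FractionModule.
Context (D : idomainType).
Local Notation F := {fraction D}.

Definition fraction_scale (a : D) (x : F) : F := tofrac a * x.

Lemma fraction_scaleA a b x :
  fraction_scale a (fraction_scale b x) = fraction_scale (a * b) x.
Proof. by rewrite /fraction_scale rmorphM mulrA. Qed.

Lemma fraction_scale1 : left_id 1 fraction_scale.
Proof. by move=> x; rewrite /fraction_scale rmorph1 mul1r. Qed.

Lemma fraction_scaleDr : right_distributive fraction_scale +%R.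
Proof. by move=> a x y; rewrite /fraction_scale mulrDr. Qed.

Lemma fraction_scaleDl x : {morph fraction_scale^~ x : a b / a + b}.
Proof. by move=> a b; rewrite /fraction_scale rmorphD mulrDl. Qed.

HB.instance Definition _ := GRing.Zmodule_isLmodule.Build D F
  fraction_scaleA fraction_scale1 fraction_scaleDr fraction_scaleDl.

Lemma fraction_scaleE (a : D) (x : F) : a *: x = tofrac a * x.
Proof. by []. Qed.

End FractionModule.

Section NonzeroSubmodules.
Context (D : idomainType).
Local Notation F := {fraction D}.

Definition nonzero_submodules : set (set F) :=
  [set I | GRing.submod_closed (mem I) /\ I <> [set 0]].

Record nzsubmod := Nzsubmod {
  nzsubmod_set :> set F;
  _ : nzsubmod_set \in nonzero_submodules
}.

HB.instance Definition _ := [isSub for nzsubmod_set].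
HB.instance Definition _ := [Choice of nzsubmod by <:].
HB.instance Definition _ :=
  [SubChoice_isSubPOrder of nzsubmod by <: with set_display].

Lemma nzsubmod_leE (I J : nzsubmod) : (I <= J)%O = (I `<=` J) :> Prop.
Proof. by rewrite -Order.le_val subsetEset. Qed.

Lemma submod_closedE (I : set F) : GRing.submod_closed (mem I) <->
  I 0 /\ forall (a : D) x y, I x -> I y -> I (a *: x + y).
Proof.
split=> -[I0 IZ]; split.
- by move: I0; rewrite inE.
- by move=> a x y Ix Iy; have := IZ a x y; rewrite !inE; apply.
- by rewrite inE.
- by move=> a x y; rewrite !inE; exact: IZ.
Qed.

Lemma nonzero_submodulesP (I : set F) : I \in nonzero_submodules <->
  [/\ I 0, forall (a : D) x y, I x -> I y -> I (a *: x + y)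
    & exists2 x, I x & x != 0].
Proof.
rewrite inE; split=> [[/submod_closedE[I0 IZ] In0]|[I0 IZ [x Ix x0]]].
  split=> //; apply: contrapT => noI; apply: In0; apply/seteqP; split=> x /=.
    by move=> Ix; apply/eqP/negPn/negP => x0; apply: noI; exists x.
  by move->.
split; first exact/submod_closedE.
by move=> I1; move: Ix x0; rewrite I1 /= => ->; rewrite eqxx.
Qed.

Lemma nzsubmodP (I : nzsubmod) :
  [/\ (I : set F) 0,
      forall (a : D) x y, (I : set F) x -> (I : set F) y ->
        (I : set F) (a *: x + y)
    & exists2 x, (I : set F) x & x != 0].
Proof. by apply/nonzero_submodulesP; case: I. Qed.

Definition one_set : set F := range (@tofrac D).

Lemma one_set_nz : one_set \in nonzero_submodules.
Proof.
apply/nonzero_submodulesP; split.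
- by exists 0; rewrite ?rmorph0.
- move=> a _ _ [x _ <-] [y _ <-]; exists (a * x + y) => //.
  by rewrite rmorphD rmorphM.
- by exists 1; [exists 1; rewrite ?rmorph1 | exact: oner_neq0].
Qed.

Definition nzsubmod_one : nzsubmod := Nzsubmod one_set_nz.

Definition mul_set (I J : set F) : set F :=
  [set x | exists n (u v : 'I_n -> F),
    [/\ forall i, I (u i), forall i, J (v i) & x = \sum_i u i * v i]].

Lemma mul_set_mem (I J : set F) x y : I x -> J y -> mul_set I J (x * y).
Proof.
by move=> Ix Jy; exists 1%N, (fun=> x), (fun=> y); rewrite big_ord1.
Qed.

Lemma mul_set_sub (I J L : set F) : GRing.submod_closed (mem L) ->
  (forall x y, I x -> J y -> L (x * y)) -> mul_set I J `<=` L.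
Proof.
move=> /submod_closedE[L0 LZ] IJL _ [n [u [v [Iu Jv ->]]]].
elim/big_ind: _ => // [x y Lx Ly|i _]; last exact: IJL.
by rewrite -[x]scale1r; exact: LZ.
Qed.

Lemma mul_set_nz (I J : nzsubmod) : mul_set I J \in nonzero_submodules.
Proof.
have [I0 IZ [x Ix x0]] := nzsubmodP I; have [_ _ [y Jy y0]] := nzsubmodP J.
apply/nonzero_submodulesP; split.
- by exists 0%N, (fun=> 0), (fun=> 0); split=> [[]|[]|] //; rewrite big_ord0.
- move=> a _ _ [n [u [v [Iu Jv ->]]]] [m [u' [v' [Iu' Jv' ->]]]].
  exists (n + m)%N,
    (fun i => match split i with inl j => a *: u j | inr j => u' j end),
    (fun i => match split i with inl j => v j | inr j => v' j end).
  split=> [i|i|].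
  + by case: (split i) => j //; rewrite -[_ *: _]addr0; exact: IZ.
  + by case: (split i).
  + rewrite big_split_ord /= scaler_sumr; congr (_ + _); apply: eq_bigr => i _.
      by rewrite (unsplitK (inl i)) !fraction_scaleE mulrA.
    by rewrite (unsplitK (inr i)).
- by exists (x * y); [exact: mul_set_mem | rewrite mulf_neq0].
Qed.

Definition nzsubmod_mul (I J : nzsubmod) : nzsubmod :=
  Nzsubmod (mul_set_nz I J).

Lemma nzsubmod_closed (I : nzsubmod) : GRing.submod_closed (mem (I : set F)).
Proof. by have [I0 IZ _] := nzsubmodP I; exact/submod_closedE. Qed.

Lemma colon_closed (A : set F) (L : nzsubmod) :
  GRing.submod_closed (mem [set x | forall y, A y -> (L : set F) (x * y)]).
Proof.
have [L0 LZ _] := nzsubmodP L; apply/submod_closedE; split=> [y _|].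
  by rewrite mul0r.
move=> a x x' Lx Lx' y Ay /=; rewrite mulrDl fraction_scaleE -mulrA.
by apply: LZ; [exact: Lx | exact: Lx'].
Qed.

Lemma mul_setC (I J : set F) : mul_set I J = mul_set J I.
Proof.
by apply/seteqP; split=> _ [n [u [v [Iu Jv ->]]]]; exists n, v, u; split=> //;
  apply: eq_bigr => i _; rewrite mulrC.
Qed.

Lemma nzsubmod_mulC : commutative nzsubmod_mul.
Proof. by move=> I J; apply/val_inj; rewrite /= mul_setC. Qed.

Lemma nzsubmod_mulA : associative nzsubmod_mul.
Proof.
have sub (I J K : nzsubmod) : nzsubmod_mul (nzsubmod_mul I J) K `<=`
    nzsubmod_mul I (nzsubmod_mul J K).
  apply: mul_set_sub; first exact: nzsubmod_closed.
  move=> x z IJx Kz; suff: mul_set I J `<=`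
    [set t | forall y, (K : set F) y ->
      mul_set I (mul_set J K) (t * y)] by move/(_ x IJx z Kz).
  apply: mul_set_sub.
    exact: (colon_closed K (nzsubmod_mul I (nzsubmod_mul J K))).
  move=> s t Is Jt y Ky; rewrite -mulrA.
  by apply: mul_set_mem => //; exact: mul_set_mem.
move=> I J K; apply/val_inj/seteqP; split; last exact: sub.
have := sub K J I.
by rewrite /= (mul_setC (mul_set K J)) (mul_setC K J) (mul_setC K)
  (mul_setC J I) (mul_setC I).
Qed.

Lemma nzsubmod_mul1 : left_id nzsubmod_one nzsubmod_mul.
Proof.
move=> I; apply/val_inj/seteqP; split=> x.
  have [I0 IZ _] := nzsubmodP I.
  apply: mul_set_sub x; first exact: nzsubmod_closed.
  by move=> _ y [a _ <-] Iy; rewrite -fraction_scaleE -[_ *: _]addr0; exact: IZ.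
by move=> Ix; rewrite -[x]mul1r; apply: mul_set_mem => //; exists 1;
  rewrite ?rmorph1.
Qed.

Lemma nzsubmod_mulr1 : right_id nzsubmod_one nzsubmod_mul.
Proof. by move=> I; rewrite nzsubmod_mulC nzsubmod_mul1. Qed.

HB.instance Definition _ :=
  isMonoid.Build nzsubmod nzsubmod_mulA nzsubmod_mul1 nzsubmod_mulr1.

Lemma nzsubmod_mulg_le (I I' J J' : nzsubmod) :
  (I <= I')%O -> (J <= J')%O -> ((I * J)%g <= (I' * J')%g)%O.
Proof.
rewrite !nzsubmod_leE => II' JJ'; apply: mul_set_sub.
  exact: (nzsubmod_closed (nzsubmod_mul I' J')).
by move=> x y /II' ? /JJ' ?; exact: mul_set_mem.
Qed.

HB.instance Definition _ :=
  isOrderedMagma.Build set_display nzsubmod nzsubmod_mulg_le.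

Lemma scale_set_nz (a : F) (a_neq0 : a != 0) (I : nzsubmod) :
  [set a * x | x in I] \in nonzero_submodules.
Proof.
have [I0 IZ [x Ix x0]] := nzsubmodP I; apply/nonzero_submodulesP; split.
- by exists 0; rewrite ?mulr0.
- move=> b _ _ [y Iy <-] [z Iz <-]; exists (b *: y + z); first exact: IZ.
  by rewrite mulrDr !fraction_scaleE mulrCA.
- by exists (a * x); [exists x | rewrite mulf_neq0].
Qed.

Definition nzsubmod_scale (a : F) (a_neq0 : a != 0) (I : nzsubmod) : nzsubmod :=
  Nzsubmod (scale_set_nz a_neq0 I).

Lemma principal_nz (x : F) (x_neq0 : x != 0) :
  [set a *: x | a in [set: D]] \in nonzero_submodules.
Proof.
apply/nonzero_submodulesP; split.
- by exists 0; rewrite ?scale0r.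
- move=> b _ _ [y _ <-] [z _ <-]; exists (b * y + z) => //.
  by rewrite scalerDl scalerA.
- by exists x => //; exists 1; rewrite ?scale1r.
Qed.

Definition principal (x : F) (x_neq0 : x != 0) : nzsubmod :=
  Nzsubmod (principal_nz x_neq0).

Definition is_fracideal : {pred nzsubmod} := fun I =>
  `[< exists2 a : F, a != 0 & forall x, (I : set F) x -> one_set (a * x) >].

Lemma is_fracideal1 : (1%g : nzsubmod) \in is_fracideal.
Proof.
by apply/asboolP; exists 1; [exact: oner_neq0 | move=> x; rewrite mul1r].
Qed.

Lemma is_fracidealM : mulg_closed is_fracideal.
Proof.
move=> I J /asboolP[a a0 aI] /asboolP[b b0 bJ]; apply/asboolP.
exists (a * b); first by rewrite mulf_neq0.
move=> x IJx; rewrite mulrC; move: x IJx.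
suff: mul_set I J `<=` [set x | forall y, [set a * b] y -> one_set (x * y)].
  by move=> IJ x IJx; exact: (IJ x IJx (a * b)).
apply: mul_set_sub; first exact: (colon_closed _ nzsubmod_one).
move=> x y /aI[c _ ac] /bJ[d _ bd] _ ->; exists (c * d) => //.
by rewrite tofracM ac bd mulrACA mulrC.
Qed.

HB.instance Definition _ := isMulClosed.Build nzsubmod is_fracideal is_fracidealM.
HB.instance Definition _ := isMul1Closed.Build nzsubmod is_fracideal is_fracideal1.

Definition fracideal := @submonoid set_display nzsubmod is_fracideal.

HB.instance Definition _ := OrderedMonoid.on fracideal.

Lemma scale_is_fracideal (a : F) (a_neq0 : a != 0) (I : fracideal) :
  nzsubmod_scale a_neq0 (\val I) \in is_fracideal.
Proof.
case: I => I /= /asboolP[b b0 bI]; apply/asboolP; exists (b / a).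
  by rewrite mulf_neq0 ?invr_eq0.
by move=> _ [x Ix <-]; rewrite mulrA divfK//; exact: bI.
Qed.

Definition fracideal_scale (a : F) (a_neq0 : a != 0) (I : fracideal) :
  fracideal := Submonoid (scale_is_fracideal a_neq0 I).

Definition semistar_operation (s : nzsubmod -> nzsubmod) : Prop :=
  closure_operation s /\
  forall (a : F) (a_neq0 : a != 0) I,
    s (nzsubmod_scale a_neq0 I) = nzsubmod_scale a_neq0 (s I).

(* D itself is the unit 1%g of the monoid of nonzero fractional ideals. *)
Definition star_operation (s : fracideal -> fracideal) : Prop :=
  [/\ closure_operation s, s 1%g = 1%g &
      forall (a : F) (a_neq0 : a != 0) I,
        s (fracideal_scale a_neq0 I) = fracideal_scale a_neq0 (s I)].

Definition semistar_le (s1 s2 : nzsubmod -> nzsubmod) : Prop :=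
  forall I, (s1 I <= s2 I)%O.

(* s maps the elements of M into M, and agrees there with c. *)
Definition restricts_to (M : umagmaClosed nzsubmod) (s : nzsubmod -> nzsubmod)
    (c : submonoid M -> submonoid M) : Prop :=
  forall J : submonoid M, s (\val J) = \val (c J).

Definition smallest_semistar_extending (M : umagmaClosed nzsubmod)
    (c : submonoid M -> submonoid M) (s : nzsubmod -> nzsubmod) : Prop :=
  [/\ semistar_operation s, restricts_to s c &
      forall s', semistar_operation s' -> restricts_to s' c -> semistar_le s s'].

End NonzeroSubmodules.

(* Main.v *)
(* The module [s I] is the smallest c-closed module containing [I], where K is
   c-closed when J <= K implies c J <= K for all J in M. For J in M, the module
   c J is c-closed, so s extends c; if s' is a semistar operation extending c,
   then [s' I] is c-closed, so s <= s'. Since a (c J) <= c (a J) for a != 0, the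
   c-closed modules are stable under scaling, so s commutes with scaling. For a
   nucleus this inequality is (a) (c J) <= c (a) (c J) <= c ((a) J). *)
Require Import Defs.
From HB Require Import structures.
From mathcomp Require Import all_boot all_order all_algebra.
From mathcomp Require Import fraction monoid.
From mathcomp Require Import boolp classical_sets.

Set Implicit Arguments.
Unset Strict Implicit.
Unset Printing Implicit Defensive.

Import GRing.Theory Order.POrderTheory.

Local Open Scope classical_set_scope.
Local Open Scope ring_scope.

Section SmallestExtension.
Context (D : idomainType).
Local Notation F := {fraction D}.

Lemma nzsubmod_scaleP (a : F) (a_neq0 : a != 0) (I : nzsubmod D) (x : F) :
  (nzsubmod_scale a_neq0 I : set F) x <-> (I : set F) (a^-1 * x).
Proof.
split=> [[y Iy <-]|Ix]; first by rewrite mulKf.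
by exists (a^-1 * x); rewrite ?mulVKf.
Qed.

(** The proof of [a^-1 != 0] is an argument of its own, so the cancellation rewrites with whichever
    proof the goal carries. *)
Lemma nzsubmod_scaleK (a : F) (a_neq0 : a != 0) (aV_neq0 : a^-1 != 0) :
  cancel (nzsubmod_scale (D := D) a_neq0) (nzsubmod_scale aV_neq0).
Proof.
move=> I; apply/val_inj/seteqP; split=> x.
  by move=> /nzsubmod_scaleP /nzsubmod_scaleP; rewrite invrK mulKf.
by move=> Ix; do 2 apply/nzsubmod_scaleP; rewrite invrK mulKf.
Qed.

Lemma nzsubmod_scaleVK (a : F) (a_neq0 : a != 0) (aV_neq0 : a^-1 != 0) :
  cancel (nzsubmod_scale (D := D) aV_neq0) (nzsubmod_scale a_neq0).
Proof.
move=> I; apply/val_inj/seteqP; split=> x.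
  by move=> /nzsubmod_scaleP /nzsubmod_scaleP; rewrite invrK mulVKf.
by move=> Ix; do 2 apply/nzsubmod_scaleP; rewrite invrK mulVKf.
Qed.

Lemma nzsubmod_scale_le (a : F) (a_neq0 : a != 0) (I J : nzsubmod D) :
  (I <= J)%O -> (nzsubmod_scale a_neq0 I <= nzsubmod_scale a_neq0 J)%O.
Proof. by rewrite !nzsubmod_leE => IJ; exact: image_subset. Qed.

(** Scaling becomes multiplication in the ordered monoid, where the inequality of a nucleus
    applies. *)
Lemma nzsubmod_scaleE (a : F) (a_neq0 : a != 0) (I : nzsubmod D) :
  nzsubmod_scale a_neq0 I = (principal a_neq0 * I)%g.
Proof.
apply/val_inj/seteqP; split=> x.
  move=> [y Iy <-]; apply: mul_set_mem => //; exists 1 => //.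
  by rewrite scale1r.
apply: mul_set_sub; first exact: (nzsubmod_closed (nzsubmod_scale a_neq0 I)).
move=> _ y [b _ <-] Iy; exists (b *: y).
  by have [I0 IZ _] := nzsubmodP I; rewrite -[_ *: _]addr0; exact: IZ.
by rewrite !fraction_scaleE mulrCA mulrA.
Qed.

Variables (M : umagmaClosed (nzsubmod D)) (c : submonoid M -> submonoid M).

Definition closed_modules : set (nzsubmod D) :=
  [set K | forall J : submonoid M, \val J `<=` K -> \val (c J) `<=` K].

Definition closed_hull_set (I : nzsubmod D) : set F :=
  \bigcap_(K in [set K : nzsubmod D | I `<=` K /\ closed_modules K]) K.

Lemma sub_closed_hull_set (I : nzsubmod D) : I `<=` closed_hull_set I.
Proof. by move=> x Ix K [+ _]; exact. Qed.

Lemma closed_hull_set_nz (I : nzsubmod D) :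
  closed_hull_set I \in @nonzero_submodules D.
Proof.
apply/nonzero_submodulesP; split=> [K _|a x y Ix Iy K KI|].
- by have [] := nzsubmodP K.
- by have [_ + _] := nzsubmodP K; apply; [exact: Ix | exact: Iy].
- by have [_ _ [x Ix x0]] := nzsubmodP I; exists x => //;
    exact: sub_closed_hull_set.
Qed.

Definition closed_hull (I : nzsubmod D) : nzsubmod D :=
  Nzsubmod (closed_hull_set_nz I).

Lemma le_closed_hull (I : nzsubmod D) : (I <= closed_hull I)%O.
Proof. by rewrite nzsubmod_leE; exact: sub_closed_hull_set. Qed.

Lemma closed_hull_min (I K : nzsubmod D) :
  closed_modules K -> (I <= K)%O -> (closed_hull I <= K)%O.
Proof. by rewrite !nzsubmod_leE => Kc IK x; apply; split. Qed.

(** A [J] inside the hull lies in every closed [K] containing [I], and then so does [c J]. *)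
Lemma closed_hull_closed (I : nzsubmod D) : closed_modules (closed_hull I).
Proof.
move=> J JI x cJx K [IK Kc]; by apply: (Kc J _ x cJx) => y Jy; exact: (JI y Jy).
Qed.

Lemma closed_hull_closure_operation : closure_operation closed_hull.
Proof.
split=> [I|I J IJ|I]; first exact: le_closed_hull.
  apply: closed_hull_min; first exact: closed_hull_closed.
  exact: (le_trans IJ (le_closed_hull J)).
apply/le_anti; rewrite le_closed_hull andbT.
by apply: closed_hull_min => //; exact: closed_hull_closed.
Qed.

Lemma closed_hull_restricts_to :
  closure_operation c -> restricts_to closed_hull c.
Proof.
move=> [c_ge c_homo cK] J; apply/le_anti/andP; split.
  apply: closed_hull_min; last by rewrite Order.le_val; exact: c_ge.
  (* [c J] is closed: [J' <= c J] gives [c J' <= c (c J) = c J]. *)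
  move=> J'; rewrite -!nzsubmod_leE !Order.le_val => /c_homo.
  by rewrite cK.
rewrite nzsubmod_leE; apply: closed_hull_closed.
exact: sub_closed_hull_set.
Qed.

(** From [J <= s I] follows [c J = s J <= s (s I) = s I]. *)
Lemma semistar_closed_modules (s : nzsubmod D -> nzsubmod D) (I : nzsubmod D) :
  semistar_operation s -> restricts_to s c -> closed_modules (s I).
Proof.
move=> [[_ s_homo sK] _] sc J; rewrite -!nzsubmod_leE => /s_homo.
by rewrite sK sc.
Qed.

(** The common form in which star operations and nuclei enter the scaling argument. It also asserts
    that [M] contains the scaled module, which each case obtains differently. *)
Hypothesis scale_sub : forall (a : F) (a_neq0 : a != 0) (J : submonoid M),
  exists2 aJ : submonoid M, \val aJ = nzsubmod_scale a_neq0 (\val J) &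
    (nzsubmod_scale a_neq0 (\val (c J)) <= \val (c aJ))%O.

(** If [J] lies in [a K], then [a^-1 J] lies in [K], hence [a^-1 (c J) <= c (a^-1 J) <= K]; scaling
    by [a] gives [c J <= a K]. *)
Lemma closed_modules_scale (a : F) (a_neq0 : a != 0) (K : nzsubmod D) :
  closed_modules K -> closed_modules (nzsubmod_scale a_neq0 K).
Proof.
move=> Kc J; have aV_neq0 : a^-1 != 0 by rewrite invr_eq0.
have [J' J'E cJ'] := scale_sub aV_neq0 J.
rewrite -!nzsubmod_leE => /(nzsubmod_scale_le aV_neq0).
rewrite nzsubmod_scaleK -J'E nzsubmod_leE => /Kc.
rewrite -nzsubmod_leE => /(le_trans cJ').
by move=> /(nzsubmod_scale_le a_neq0); rewrite nzsubmod_scaleVK.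
Qed.

Lemma closed_hull_scale_le (a : F) (a_neq0 : a != 0) (I : nzsubmod D) :
  (closed_hull (nzsubmod_scale a_neq0 I) <=
   nzsubmod_scale a_neq0 (closed_hull I))%O.
Proof.
apply: closed_hull_min; last by apply: nzsubmod_scale_le; exact: le_closed_hull.
by apply: closed_modules_scale; exact: closed_hull_closed.
Qed.

Lemma closed_hull_semistar : semistar_operation closed_hull.
Proof.
split=> [|a a_neq0 I]; first exact: closed_hull_closure_operation.
apply/le_anti; rewrite closed_hull_scale_le /=.
(* The reverse inclusion is the one just used, taken for [a^-1] and [a I] and then scaled by [a]. *)
have aV_neq0 : a^-1 != 0 by rewrite invr_eq0.
have := closed_hull_scale_le aV_neq0 (nzsubmod_scale a_neq0 I).
by move=> /(nzsubmod_scale_le a_neq0); rewrite nzsubmod_scaleK nzsubmod_scaleVK.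
Qed.

Lemma closed_hull_smallest :
  closure_operation c -> smallest_semistar_extending c closed_hull.
Proof.
move=> c_closure; split=> [||s s_semistar sc I].
- exact: closed_hull_semistar.
- exact: closed_hull_restricts_to.
- apply: closed_hull_min; first exact: semistar_closed_modules.
  by case: s_semistar => -[+ _ _] _; apply.
Qed.

(** Two smallest extensions lie below each other pointwise, so antisymmetry and function
    extensionality identify them. *)
Lemma smallest_semistar_unique (s : nzsubmod D -> nzsubmod D) :
  smallest_semistar_extending c s -> unique (smallest_semistar_extending c) s.
Proof.
move=> s_min; split=> // s' [s'_semistar s'c s'_min].
case: s_min => ss sc s_min.
apply/funext => I; apply/le_anti/andP; split.
  exact: s_min.
exact: s'_min.
Qed.

End SmallestExtension.

Lemma star_scale_sub (D : idomainType) (c : fracideal D -> fracideal D) :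
  star_operation c ->
  forall (a : {fraction D}) (a_neq0 : a != 0) (J : fracideal D),
    exists2 aJ : fracideal D, \val aJ = nzsubmod_scale a_neq0 (\val J) &
      (nzsubmod_scale a_neq0 (\val (c J)) <= \val (c aJ))%O.
Proof.
by move=> [_ _ cZ] a a_neq0 J; exists (fracideal_scale a_neq0 J); rewrite ?cZ.
Qed.

Lemma nucleus_scale_sub (D : idomainType) (M : umagmaClosed (nzsubmod D))
    (c : submonoid M -> submonoid M) :
  (forall (x : {fraction D}) (x_neq0 : x != 0), principal x_neq0 \in M) ->
  nucleus c ->
  forall (a : {fraction D}) (a_neq0 : a != 0) (J : submonoid M),
    exists2 aJ : submonoid M, \val aJ = nzsubmod_scale a_neq0 (\val J) &
      (nzsubmod_scale a_neq0 (\val (c J)) <= \val (c aJ))%O.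
Proof.
move=> Mprin [[c_ge _ _] cM] a a_neq0 J.
(* [P] is the principal module [D a]; as [M] is closed under products, [P * J] is the module [a J]
   inside [M]. *)
pose P : submonoid M := Submonoid (Mprin a a_neq0).
exists (P * J)%g; first by rewrite valM nzsubmod_scaleE.
have := cM P J; rewrite -Order.le_val valM; apply: le_trans.
rewrite nzsubmod_scaleE; apply: mulg_le; last exact: le_refl.
by have := c_ge P; rewrite -Order.le_val.
Qed.

Theorem proposition13p4 (D : idomainType) :
  (forall c : fracideal D -> fracideal D, star_operation c ->
    exists s : nzsubmod D -> nzsubmod D,
      unique (smallest_semistar_extending c) s /\
      forall I : nzsubmod D,
        s I = \bigcap_(K in [set K : nzsubmod D | I `<=` K /\
                forall J : fracideal D, \val J `<=` K -> \val (c J) `<=` K]) K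
          :> set {fraction D})
  /\
  (forall (M : umagmaClosed (nzsubmod D)) (c : submonoid M -> submonoid M),
    (forall (x : {fraction D}) (x_neq0 : x != 0), principal x_neq0 \in M) ->
    nucleus c ->
    exists s : nzsubmod D -> nzsubmod D,
      unique (smallest_semistar_extending c) s /\
      forall I : nzsubmod D,
        s I = \bigcap_(K in [set K : nzsubmod D | I `<=` K /\
                forall J : submonoid M, \val J `<=` K -> \val (c J) `<=` K]) K
          :> set {fraction D}).
Proof.
(* The intersection formula holds by unfolding [closed_hull], so only the extremal property is left
   in each case. *)
split=> [c c_star|M c Mprin c_nucleus]; exists (closed_hull c); split=> //;
  apply: smallest_semistar_unique; apply: closed_hull_smallest.
- exact: star_scale_sub.
- by case: c_star.
- exact: nucleus_scale_sub.
- by case: c_nucleus.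
Qed.
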